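(* Let $n\ge 1$. For any $z_1,\dots,z_n\in\mathbb{D}$ (not necessarily distinct) there is a non-trivial probability measure $\mu$ on $\partial\mathbb{D}$ such that the eigenvalues of the compressed multiplication operator $A^\mu=P_nM_zP_n\restriction\mathcal{P}_{n-1}$, counted with algebraic multiplicity, are $z_1,\dots,z_n$. Moreover, any two compressed multiplication operators $A^\mu$, $A^\nu$ of dimension $n$ with the same characteristic polynomial are unitarily equivalent.
   Context: $\mathbb{D}=\{z\in\mathbb{C}:|z|<1\}$. A probability measure $\mu$ on $\partial\mathbb{D}$ is non-trivial if it is not supported on a finite set. $\mathcal{P}_{n-1}$ is the space of complex polynomials of degree at most $n-1$, viewed as an $n$-dimensional subspace of $L^2(\partial\mathbb{D},d\mu)$ with the inherited inner product; $P_n$ is the orthogonal projection of $L^2(\partial\mathbb{D},d\mu)$ onto $\mathcal{P}_{n-1}$; $M_z$ is multiplication by $z$ on $L^2(\partial\mathbb{D},d\mu)$. The compressed multiplication operator of $\mu$ (of dimension $n$) is $A^\mu=P_nM_zP_n\restriction\mathcal{P}_{n-1}$. *)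

(* Defs.v *)
From HB Require Import structures.
From mathcomp Require Import all_boot all_order all_algebra.
From mathcomp Require Import qpoly complex ring lra.
From mathcomp Require Import all_classical all_reals all_analysis measurable_realfun.

Set Implicit Arguments.
Unset Strict Implicit.
Unset Printing Implicit Defensive.

Import Order.TTheory GRing.Theory Num.Theory numFieldNormedType.Exports.

Local Open Scope classical_set_scope.
Local Open Scope ring_scope.
Local Open Scope complex_scope.

Definition unit_circle (R : realType) : set (R[i])^o := [set z | `|z| = 1].
Arguments unit_circle R : clear implicits.

HB.instance Definition _ (R : realType) :=
  isPointed.Build (set_type (unit_circle R))
    (exist _ 1 (mem_set (normr1 R[i] : unit_circle R 1))).

(* Borel sigma-algebra of the subspace topology inherited from C. *)
Definition circle (R : realType) :=
  g_sigma_algebraType (@open (set_type (unit_circle R))).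
HB.instance Definition _ (R : realType) := Measurable.on (circle R).

Definition circle_val (R : realType) (z : circle R) : R[i] := set_val z.

Section CompressedMultiplication.
Context {R : realType}.
Local Notation C := R[i].
Implicit Types (mu : probability (circle R) R) (f g : circle R -> C).

Definition nontrivial mu : Prop :=
  ~ exists F : set (circle R), finite_set F /\ mu (~` F) = 0%E.

Definition cintegral mu f : C :=
  (\int[mu]_z complex.Re (f z)) +i* (\int[mu]_z complex.Im (f z)).

(* Elements of L^2 are represented by square-integrable functions; the inner
   product is linear in its first argument. *)
Definition L2 mu f : Prop :=
  [/\ measurable_fun setT (fun z => complex.Re (f z)),
      measurable_fun setT (fun z => complex.Im (f z)) &
      mu.-integrable setT
        (fun z => (complex.Re (f z) ^+ 2 + complex.Im (f z) ^+ 2)%:E)].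

Definition inner mu f g : C := cintegral mu (fun z => f z * (g z)^*).

Definition poly_fun n (p : {poly_n C}) : circle R -> C :=
  fun z => (p : {poly C}).[circle_val z].

(* For mu nontrivial and f in L^2 exactly one p satisfies the orthogonality
   condition (orth_projP). *)
Definition orth_proj mu n f : {poly_n C} :=
  xget 0 [set p : {poly_n C} |
    forall q : {poly_n C}, inner mu (f \- poly_fun p) (poly_fun q) = 0].

Definition mult_z f : circle R -> C := fun z => circle_val z * f z.

(* linfun gives the intended operator only for a linear argument; for mu
   nontrivial it does, see compressed_multE. *)
Definition compressed_mult mu n : 'End({poly_n C}) :=
  linfun (fun p : {poly_n C} =>
    orth_proj mu n (mult_z (poly_fun (orth_proj mu n (poly_fun p))))).

(* Row i of the matrix lists the coefficients of A 'X^i. *)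
Definition op_char_poly n (A : 'End({poly_n C})) : {poly C} :=
  char_poly (\matrix_(i < n, j < n) (A (tnth (npolyX C n) i) : {poly C})`_j).

Definition alg_mult n (A : 'End({poly_n C})) (a : C) : nat :=
  mup a (op_char_poly A).

(* A acts on {poly_n C} with the inner product of L^2(mu), B on {poly_n C} with
   that of L^2(nu). *)
Definition unitarily_equivalent mu nu n (A B : 'End({poly_n C})) : Prop :=
  exists U : 'End({poly_n C}),
    [/\ bijective U,
        forall p q, inner nu (poly_fun (U p)) (poly_fun (U q)) =
                    inner mu (poly_fun p) (poly_fun q) &
        (U \o A)%VF = (B \o U)%VF].

End CompressedMultiplication.

Section Facts.
Context {R : realType}.
Local Notation C := R[i].
Local Notation Re := (@complex.Re R).
Local Notation Im := (@complex.Im R).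
Implicit Types (mu : probability (circle R) R) (f g : circle R -> C).

Let continuous_measurable_circle (r : C -> R) :
    (forall w y : C, `|r w - r y|%:C <= `|w - y|) ->
  measurable_fun setT (fun z : circle R => r (circle_val z)).
Proof.
move=> rlip; apply: (measurability _ (RGenOInfty.measurableE R)).
move=> _ [_ [x ->] <-].
rewrite setTI; apply: sub_sigma_algebra.
exists [set w : C^o | x < r w]; last first.
  by apply/seteqP; split => z /=; rewrite in_itv/= andbT.
rewrite openE => w /= xw; apply/nbhs_ballP.
exists (r w - x)%:C; first by rewrite /= ltcR subr_gt0.
move=> y /=; rewrite /ball /= => wy.
have := le_lt_trans (rlip w y) wy; rewrite ltcR => /ltr_normlW; lra.
Qed.

Lemma measurable_Re_circle :
  measurable_fun setT (fun z : circle R => Re (circle_val z)).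
Proof.
by apply: continuous_measurable_circle => w y; rewrite -raddfB normc_ge_Re.
Qed.

Lemma measurable_Im_circle :
  measurable_fun setT (fun z : circle R => Im (circle_val z)).
Proof.
apply: continuous_measurable_circle => w y.
rewrite -raddfB normc_def lecR -sqrtr_sqr ler_wsqrtr//.
by rewrite lerDr sqr_ge0.
Qed.

Let bm (h : circle R -> R) :=
  measurable_fun setT h /\ exists M, forall z, `|h z| <= M.

Let bmD h k : bm h -> bm k -> bm (fun z => h z + k z).
Proof.
move=> [mh [M hM]] [mk [N kN]]; split; first exact: measurable_funD.
by exists (M + N) => z; apply: (le_trans (ler_normD _ _)); exact: lerD.
Qed.

Let bmM h k : bm h -> bm k -> bm (fun z => h z * k z).
Proof.
move=> [mh [M hM]] [mk [N kN]]; split; first exact: measurable_funM.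
by exists (M * N) => z; rewrite normrM ler_pM.
Qed.

Let bm_cst c : bm (fun=> c).
Proof. by split; [exact: measurable_cst|exists `|c|]. Qed.

Let bmN h : bm h -> bm (fun z => - h z).
Proof.
move=> bh; rewrite (_ : (fun _ => _) = fun z => (-1) * h z).
  by apply: bmM => //; exact: bm_cst.
by apply/funext => z; rewrite mulN1r.
Qed.

Let bm_integrable mu h : bm h -> mu.-integrable setT (EFin \o h).
Proof.
move=> [mh [M hM]]; apply: measurable_bounded_integrable => //.
  by rewrite ltey_eq fin_num_measure.
by exists M; split; rewrite ?num_real// => N MN z _; exact: le_trans (ltW MN).
Qed.

Let bmc f := bm (fun z => Re (f z)) /\ bm (fun z => Im (f z)).

Let bmcD f g : bmc f -> bmc g -> bmc (fun z => f z + g z).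
Proof.
move=> [fr fi] [gr gi]; split.
  rewrite (_ : (fun _ => _) = fun z => Re (f z) + Re (g z)); first exact: bmD.
  by apply/funext => z; rewrite raddfD.
rewrite (_ : (fun _ => _) = fun z => Im (f z) + Im (g z)); first exact: bmD.
by apply/funext => z; rewrite raddfD.
Qed.

Let ReM (x y : C) : Re (x * y) = Re x * Re y - Im x * Im y.
Proof. by case: x; case: y. Qed.

Let ImM (x y : C) : Im (x * y) = Re x * Im y + Im x * Re y.
Proof. by case: x; case: y. Qed.

Let ReJ (x : C) : Re x^* = Re x. Proof. by case: x. Qed.

Let ImJ (x : C) : Im x^* = - Im x. Proof. by case: x. Qed.

Let ReD (x y : C) : Re (x + y) = Re x + Re y. Proof. by case: x; case: y. Qed.

Let ImD (x y : C) : Im (x + y) = Im x + Im y. Proof. by case: x; case: y. Qed.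

Let ReN (x : C) : Re (- x) = - Re x. Proof. by case: x. Qed.

Let ImN (x : C) : Im (- x) = - Im x. Proof. by case: x. Qed.

Let bmcM f g : bmc f -> bmc g -> bmc (fun z => f z * g z).
Proof.
move=> [fr fi] [gr gi]; split.
  under [X in bm X]eq_fun do rewrite ReM.
  by apply: bmD; [exact: bmM|apply: bmN; exact: bmM].
under [X in bm X]eq_fun do rewrite ImM.
by apply: bmD; exact: bmM.
Qed.

Let bmc_circle : bmc (@circle_val R).
Proof.
have normRI (z : circle R) : Re (circle_val z) ^+ 2 + Im (circle_val z) ^+ 2 = 1.
  apply: complexI; rewrite add_Re2_Im2.
  by have /set_mem := valP z; rewrite /unit_circle /= => ->; rewrite expr1n.
split; split.
- exact: measurable_Re_circle.
- exists 1 => z; by rewrite -sqrtr1 -sqrtr_sqr ler_wsqrtr// -(normRI z) lerDl sqr_ge0.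
- exact: measurable_Im_circle.
- exists 1 => z; by rewrite -sqrtr1 -sqrtr_sqr ler_wsqrtr// -(normRI z) lerDr sqr_ge0.
Qed.

Let bmc_poly n (p : {poly_n C}) : bmc (poly_fun p).
Proof.
rewrite /poly_fun; elim/poly_ind: (p : {poly C}) => [|q c ih].
  by under [X in bmc X]eq_fun do rewrite horner0; split; exact: bm_cst.
under [X in bmc X]eq_fun do rewrite hornerMXaddC.
by apply: bmcD; [exact: bmcM|split; exact: bm_cst].
Qed.

Let bmc_L2 mu f : bmc f -> L2 mu f.
Proof.
move=> [fr fi]; split; [exact: fr.1|exact: fi.1|].
apply: (@bm_integrable mu (fun z => Re (f z) ^+ 2 + Im (f z) ^+ 2)).
by apply: bmD; exact: bmM.
Qed.

Lemma L2_poly mu n (p : {poly_n C}) : L2 mu (poly_fun p).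
Proof. exact: bmc_L2. Qed.

Lemma L2_mult_z mu f : L2 mu f -> L2 mu (mult_z f).
Proof.
move=> [fr fi fsq]; have [[zr _] [zi _]] := bmc_circle; split.
- under eq_fun do rewrite ReM.
  by apply: measurable_funB; exact: measurable_funM.
- under eq_fun do rewrite ImM.
  by apply: measurable_funD; exact: measurable_funM.
- rewrite (_ : (fun _ => _) =
      (fun z => (Re (f z) ^+ 2 + Im (f z) ^+ 2)%:E)) //.
  apply/funext => z; congr EFin; apply: complexI.
  rewrite !add_Re2_Im2 normrM exprMn.
  have /set_mem := valP z; rewrite /unit_circle /= => zE.
  by rewrite [X in X ^+ 2 * _](_ : _ = 1) ?expr1n ?mul1r.
Qed.


Let sq_sum_le (a b c d : R) : (a + b) ^+ 2 + (c + d) ^+ 2 <=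
  a ^+ 2 + c ^+ 2 + (a ^+ 2 + c ^+ 2) + (b ^+ 2 + d ^+ 2 + (b ^+ 2 + d ^+ 2)).
Proof.
rewrite -subr_ge0 [leRHS](_ : _ = (a - b) ^+ 2 + (c - d) ^+ 2); last by ring.
by rewrite addr_ge0 ?sqr_ge0.
Qed.

Let dot_le (a b c d : R) :
  `|a * c + b * d| <= a ^+ 2 + b ^+ 2 + (c ^+ 2 + d ^+ 2).
Proof.
have h (x y : R) : `|x * y| <= x ^+ 2 + y ^+ 2.
  rewrite normrM -(real_normK (num_real x)) -(real_normK (num_real y)).
  have := sqr_ge0 (`|x| - `|y|); have := normr_ge0 x; have := normr_ge0 y; nra.
apply: (le_trans (ler_normD _ _)); have := h a c; have := h b d; lra.
Qed.

Lemma L2D mu f g : L2 mu f -> L2 mu g -> L2 mu (fun z => f z + g z).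
Proof.
move=> [fr fi fs] [gr gi gs]; split.
- by under eq_fun do rewrite ReD; exact: measurable_funD.
- by under eq_fun do rewrite ImD; exact: measurable_funD.
- have fgs : mu.-integrable setT (fun z =>
      ((Re (f z) ^+ 2 + Im (f z) ^+ 2) + (Re (f z) ^+ 2 + Im (f z) ^+ 2) +
       ((Re (g z) ^+ 2 + Im (g z) ^+ 2) + (Re (g z) ^+ 2 + Im (g z) ^+ 2)))%:E).
    have := integrableD measurableT (integrableD measurableT fs fs)
      (integrableD measurableT gs gs).
    by apply: eq_integrable.
  apply: le_integrable fgs => //.
    apply/measurable_EFinP; apply: measurable_funD; apply: measurable_funX.
      by under eq_fun do rewrite ReD; exact: measurable_funD.
    by under eq_fun do rewrite ImD; exact: measurable_funD.
  move=> z _ /=; rewrite ?abse_EFin lee_fin ReD ImD.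
  rewrite !ger0_norm ?addr_ge0 ?sqr_ge0//.
Qed.

Lemma L2Z mu (c : C) f : L2 mu f -> L2 mu (fun z => c * f z).
Proof.
move=> [fr fi fs].
have mr : measurable_fun setT (fun z => Re (c * f z)).
  under eq_fun do rewrite ReM.
  by apply: measurable_funB; apply: measurable_funM => //; exact: measurable_cst.
have mi : measurable_fun setT (fun z => Im (c * f z)).
  under eq_fun do rewrite ImM.
  by apply: measurable_funD; apply: measurable_funM => //; exact: measurable_cst.
split => //.
have := integrableZl (mu := mu) measurableT (Re c ^+ 2 + Im c ^+ 2) fs.
rewrite (_ : (fun _ => _) =
   fun z => (Re (c * f z) ^+ 2 + Im (c * f z) ^+ 2)%:E) //.
by apply/funext => z; rewrite -EFinM ReM ImM; congr EFin; ring.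
Qed.

Let cintegrable mu f := mu.-integrable setT (fun z => (Re (f z))%:E) /\
  mu.-integrable setT (fun z => (Im (f z))%:E).

Let L2_cintegrable mu f g : L2 mu f -> L2 mu g ->
  cintegrable mu (fun z => f z * (g z)^*).
Proof.
move=> [fr fi fs] [gr gi gs]; have fgs : mu.-integrable setT (fun z =>
    (Re (f z) ^+ 2 + Im (f z) ^+ 2 + (Re (g z) ^+ 2 + Im (g z) ^+ 2))%:E).
  by have := integrableD measurableT fs gs; apply: eq_integrable.
split.
  apply: le_integrable fgs => //.
    apply/measurable_EFinP; under eq_fun do rewrite ReM ReJ ImJ mulrN opprK.
    by apply: measurable_funD; exact: measurable_funM.
  move=> z _ /=; rewrite ?abse_EFin lee_fin ReM ReJ ImJ.
  rewrite [leRHS]ger0_norm ?addr_ge0 ?sqr_ge0// mulrN opprK.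
  exact: dot_le.
apply: le_integrable fgs => //.
  apply/measurable_EFinP; under eq_fun do rewrite ImM ReJ ImJ mulrN addrC.
  by apply: measurable_funB; exact: measurable_funM.
move=> z _ /=; rewrite ?abse_EFin lee_fin ImM ReJ ImJ.
rewrite [leRHS]ger0_norm ?addr_ge0 ?sqr_ge0//.
rewrite mulrN -mulNr; apply: (le_trans (dot_le _ _ _ _)); rewrite sqrrN; lra.
Qed.

Let cintegralD mu f g : cintegrable mu f -> cintegrable mu g ->
  cintegral mu (fun z => f z + g z) = cintegral mu f + cintegral mu g.
Proof.
move=> [fr fi] [gr gi]; rewrite /cintegral.
under eq_Rintegral do rewrite ReD.
under [X in _ +i* X]eq_Rintegral do rewrite ImD.
by rewrite !RintegralD.
Qed.

Let cintegralZ mu (c : C) f : cintegrable mu f ->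
  cintegral mu (fun z => c * f z) = c * cintegral mu f.
Proof.
move=> [fr fi]; rewrite /cintegral.
under eq_Rintegral do rewrite ReM.
under [X in _ +i* X]eq_Rintegral do rewrite ImM.
have Z k h : mu.-integrable setT (EFin \o h) ->
    mu.-integrable setT (EFin \o (fun z => k * h z)).
  by move=> ih; have := integrableZl (mu := mu) measurableT k ih.
rewrite RintegralB ?RintegralD ?RintegralZl//; do ?exact: Z.
by case: (c).
Qed.

Lemma innerDl mu f1 f2 g : L2 mu f1 -> L2 mu f2 -> L2 mu g ->
  inner mu (fun z => f1 z + f2 z) g = inner mu f1 g + inner mu f2 g.
Proof.
move=> Lf1 Lf2 Lg; rewrite /inner -cintegralD; do ?exact: L2_cintegrable.
by congr cintegral; apply/funext => z; rewrite mulrDl.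
Qed.

Lemma innerZl mu (c : C) f g : L2 mu f -> L2 mu g ->
  inner mu (fun z => c * f z) g = c * inner mu f g.
Proof.
move=> Lf Lg; rewrite /inner -cintegralZ; last exact: L2_cintegrable.
by congr cintegral; apply/funext => z; rewrite mulrA.
Qed.

Lemma innerC mu f g : L2 mu f -> L2 mu g -> inner mu g f = (inner mu f g)^*.
Proof.
move=> Lf Lg; have [ir ii] := L2_cintegrable Lf Lg.
rewrite /inner /cintegral /=; congr (_ +i* _).
  by apply: eq_Rintegral => z _; rewrite !ReM !ReJ !ImJ; ring.
rewrite -mulN1r -RintegralZl//.
by apply: eq_Rintegral => z _; rewrite !ImM !ReJ !ImJ; ring.
Qed.

Lemma poly_funD n (p q : {poly_n C}) :
  poly_fun (p + q) = (fun z => poly_fun p z + poly_fun q z) :> (circle R -> C).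
Proof. by apply/funext => z; rewrite /poly_fun hornerD. Qed.

Lemma poly_funZ n (c : C) (p : {poly_n C}) :
  poly_fun (c *: p) = (fun z => c * poly_fun p z) :> (circle R -> C).
Proof. by apply/funext => z; rewrite /poly_fun hornerZ. Qed.

Lemma inner_poly_definite mu n (p : {poly_n C}) : nontrivial mu ->
  inner mu (poly_fun p) (poly_fun p) = 0 -> p = 0.
Proof.
move=> ntmu; set s := fun z : circle R => Re (poly_fun p z) ^+ 2 + Im (poly_fun p z) ^+ 2.
have [mr mi ints] := L2_poly mu p; move=> [+ _].
rewrite [X in X = _ -> _](_ : _ = \int[mu]_z s z); last first.
  by apply: eq_Rintegral => z _; rewrite /s ReM ReJ ImJ mulrN opprK.
move=> s0; have sge0 z : 0 <= s z by rewrite addr_ge0 ?sqr_ge0.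
have ms : measurable_fun setT s.
  by apply: measurable_funD; exact: measurable_funX.
have : (\int[mu]_z `|(s z)%:E|)%E = 0%E.
  rewrite (eq_integral (fun z => (s z)%:E)); last first.
    by move=> z _; rewrite abse_EFin ger0_norm.
  by rewrite -(fineK (integrable_fin_num measurableT ints)) -/(Rintegral _ _ _) s0.
move/ae_eq_integral_abs => /(_ measurableT) []; first exact/measurable_EFinP.
move=> N [mN muN sN].
have sE z : s z = 0 <-> root (p : {poly C}) (circle_val z).
  split; rewrite /root -/(poly_fun p z) /s.
    by move/eqP; rewrite paddr_eq0 ?sqr_ge0// !sqrf_eq0 eq_complex.
  by move/eqP => ->; rewrite expr0n addr0.
apply: contrapT => /eqP p0; apply: ntmu.
exists [set z : circle R | s z = 0]; split.
  have [r pE] := closed_field_poly_normal (p : {poly C}).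
  have -> : [set z : circle R | s z = 0] =
      (@circle_val R) @^-1` [set` r].
    apply/seteqP; split => z /=; rewrite sE pE rootZ ?root_prod_XsubC//;
    by rewrite lead_coef_eq0.
  apply: finite_preimage; last exact: finite_seq.
  by move=> x y _ _; exact: val_inj.
apply/eqP; rewrite -measure_le0 -muN; apply: le_measure; rewrite ?inE//.
  apply: measurableC; rewrite -[X in measurable X]setTI.
  exact: (ms measurableT [set 0]).
by move=> z /= sz; apply: sN => /=; apply/not_implyP; split => //= -[].
Qed.

Lemma orth_uniq mu n f (p p' : {poly_n C}) : nontrivial mu -> L2 mu f ->
  (forall q : {poly_n C}, inner mu (f \- poly_fun p) (poly_fun q) = 0) ->
  (forall q : {poly_n C}, inner mu (f \- poly_fun p') (poly_fun q) = 0) ->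
  p = p'.
Proof.
move=> ntmu Lf ph p'h; apply/eqP; rewrite -subr_eq0; apply/eqP.
apply: (inner_poly_definite ntmu); set d := p - p'.
have Lm (q : {poly_n C}) : L2 mu (f \- poly_fun q).
  have -> : f \- poly_fun q = fun z => f z + poly_fun ((-1) *: q) z.
    by apply/funext => z /=; rewrite poly_funZ mulN1r.
  by apply: L2D => //; exact: L2_poly.
have := p'h d; have -> : f \- poly_fun p' =
    fun z => (f \- poly_fun p) z + poly_fun d z.
  apply/funext => z /=; rewrite /d -(scaleN1r p') poly_funD poly_funZ; ring.
by rewrite innerDl ?ph ?add0r//; exact: L2_poly.
Qed.

Let e n (i : 'I_n) : {poly_n C} := tnth (npolyX C n) i.

Let npolyE n (p : {poly_n C}) : p = \sum_(i < n) (p : {poly C})`_i *: e i.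
Proof.
rewrite [LHS](coord_basis (npolyX_full C n) (memvf p)).
by apply: eq_bigr => i _; rewrite npolyX_coords /e (tnth_nth 0).
Qed.

Let inner_sum mu n (u : 'I_n -> C) f : L2 mu f ->
  inner mu (poly_fun (\sum_i u i *: e i)) f =
  \sum_i u i * inner mu (poly_fun (e i)) f.
Proof.
move=> Lf; elim/big_rec2: _ => [|i y x _ ih].
  rewrite (_ : poly_fun _ = fun z => 0 * poly_fun (0 : {poly_n C}) z).
    by rewrite innerZl ?mul0r//; exact: L2_poly.
  by apply/funext => z; rewrite /poly_fun horner0 mulr0.
by rewrite poly_funD innerDl ?poly_funZ ?innerZl ?ih//;
  try apply: L2Z; exact: L2_poly.
Qed.

Let orth_basis mu n f : L2 mu f ->
  (forall j : 'I_n, inner mu f (poly_fun (e j)) = 0) ->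
  forall q : {poly_n C}, inner mu f (poly_fun q) = 0.
Proof.
move=> Lf fe q; rewrite innerC//; last exact: L2_poly.
rewrite (npolyE q) inner_sum// big1 ?conjc0// => i _.
by rewrite innerC ?fe ?conjc0 ?mulr0//; exact: L2_poly.
Qed.

Let orth_exists mu n f : nontrivial mu -> L2 mu f ->
  exists p : {poly_n C},
    forall q : {poly_n C}, inner mu (f \- poly_fun p) (poly_fun q) = 0.
Proof.
move=> ntmu Lf; have Lp := @L2_poly mu n.
pose G : 'M[C]_n := \matrix_(i, j) inner mu (poly_fun (e i)) (poly_fun (e j)).
have GE (u : 'rV[C]_n) j : (u *m G) 0 j =
    inner mu (poly_fun (\sum_i u 0 i *: e i)) (poly_fun (e j)).
  by rewrite inner_sum// mxE; apply: eq_bigr => i _; rewrite mxE.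
have Gu : G \in unitmx.
  rewrite -row_free_unit; apply: inj_row_free => u uG.
  have p0 : \sum_i u 0 i *: e i = 0.
    apply: (inner_poly_definite ntmu); apply: orth_basis => // j.
    by rewrite -GE uG mxE.
  apply/rowP => i; rewrite mxE.
  have /freeP := npolyX_free C n.
  by apply; rewrite -[RHS]p0; apply: eq_bigr => j _; rewrite /e (tnth_nth 0).
pose u := (\row_j inner mu f (poly_fun (e j))) *m invmx G.
exists (\sum_i u 0 i *: e i); set p := \sum_i _.
have mE : f \- poly_fun p = fun z => f z + (-1) * poly_fun p z.
  by apply/funext => z /=; rewrite mulN1r.
apply: orth_basis => [|j].
  by rewrite mE; apply: L2D => //; exact: L2Z.
rewrite mE innerDl ?innerZl//; last exact: L2Z.
by rewrite -GE /u mulmxKV// mxE mulN1r subrr.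
Qed.

Lemma orth_projP mu n f (p : {poly_n C}) : nontrivial mu -> L2 mu f ->
  p = orth_proj mu n f <->
  forall q : {poly_n C}, inner mu (f \- poly_fun p) (poly_fun q) = 0.
Proof.
move=> ntmu Lf; have [p0 p0P] := orth_exists n ntmu Lf.
have := @xgetPex {poly_n C} 0 [set p : {poly_n C} |
  forall q : {poly_n C}, inner mu (f \- poly_fun p) (poly_fun q) = 0].
move=> /(_ (ex_intro _ p0 p0P)) pP; split => [-> //|h].
exact: orth_uniq pP.
Qed.

Lemma compressed_multE mu n (p : {poly_n C}) : nontrivial mu ->
  compressed_mult mu n p =
  orth_proj mu n (mult_z (poly_fun (orth_proj mu n (poly_fun p)))).
Proof.
move=> ntmu.
have projK (q : {poly_n C}) : orth_proj mu n (poly_fun q) = q.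
  apply/esym/orth_projP => // [|r]; first exact: L2_poly.
  have -> : poly_fun q \- poly_fun q = fun z => 0 * poly_fun q z.
    by apply/funext => z /=; rewrite subrr mul0r.
  by rewrite innerZl ?mul0r//; exact: L2_poly.
pose F (p : {poly_n C}) : {poly_n C} :=
  orth_proj mu n (mult_z (poly_fun (orth_proj mu n (poly_fun p)))).
have Lz (q : {poly_n C}) : L2 mu (mult_z (poly_fun q)).
  by apply: L2_mult_z; exact: L2_poly.
have Lm (q r : {poly_n C}) : L2 mu (mult_z (poly_fun q) \- poly_fun r).
  have -> : mult_z (poly_fun q) \- poly_fun r =
      fun z => mult_z (poly_fun q) z + poly_fun ((-1) *: r) z.
    by apply/funext => z /=; rewrite poly_funZ mulN1r.
  by apply: L2D => //; exact: L2_poly.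
have Flin : linear F.
  move=> c q r; apply/esym/orth_projP => // s; rewrite !projK.
  have -> : mult_z (poly_fun (c *: q + r)) \- poly_fun (c *: F q + F r) =
    fun z => c * (mult_z (poly_fun q) \- poly_fun (F q)) z +
             (mult_z (poly_fun r) \- poly_fun (F r)) z.
    apply/funext => z; rewrite /mult_z; move: (F q) (F r) => Fq Fr /=.
    rewrite !poly_funD !poly_funZ.
    move: (poly_fun q z) (poly_fun r z) (poly_fun Fq z) (poly_fun Fr z) => *.
    by ring.
  have FP t : inner mu (mult_z (poly_fun t) \- poly_fun (F t)) (poly_fun s) = 0.
    by apply: (orth_projP _ ntmu (Lz t)).1; rewrite /F projK.
  have Ls := L2_poly mu s.
  apply: (etrans (innerDl (L2Z c (Lm q (F q))) (Lm r (F r)) Ls)).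
  apply: (etrans (congr2 +%R (innerZl c (Lm q (F q)) Ls) (FP r))).
  by apply: (etrans (congr1 (fun x => c * x + 0) (FP q))); rewrite mulr0 addr0.
pose L : {linear {poly_n C} -> {poly_n C}} :=
  HB.pack F (GRing.isLinear.Build _ _ _ _ F Flin).
exact: (lfunE L).
Qed.

Lemma alg_mult_gt0 n (A : 'End({poly_n C})) (a : C) :
  (0 < alg_mult A a)%N <-> exists2 p, p != 0 & A p = a *: p.
Proof.
rewrite /alg_mult /op_char_poly; set M := \matrix_(i, j) _.
rewrite mup_geq ?monic_neq0 ?char_poly_monic// expr1 dvdp_XsubCl -eigenvalue_root_char.
pose P (v : 'rV[C]_n) : {poly_n C} := \sum_i v 0 i *: e i.
have coefP v (j : 'I_n) : (P v : {poly C})`_j = v 0 j.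
  rewrite raddf_sum /= coef_sum (bigD1 j)//= big1 ?addr0 => [|i ij].
    by rewrite /e npolyXE coefZ coefXn eqxx mulr1.
  by rewrite /e npolyXE coefZ coefXn eq_sym (inj_eq val_inj) (negbTE ij) mulr0.
have PM v : A (P v) = P (v *m M).
  apply/npolyP => k; have [kn|nk] := ltnP k n; last by rewrite !big_coef_npoly.
  rewrite -[k]/(val (Ordinal kn)) coefP mxE linear_sum raddf_sum /= coef_sum.
  by apply: eq_bigr => i _; rewrite linearZ coefZ mxE.
have PZ c v : c *: P v = P (c *: v).
  by rewrite scaler_sumr; apply: eq_bigr => i _; rewrite mxE scalerA.
have P_inj : injective P.
  by move=> v w vw; apply/rowP => i; rewrite -!coefP vw.
have P_surj p : exists v, p = P v.
  exists (\row_i (p : {poly C})`_i); rewrite [LHS]npolyE.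
  by apply: eq_bigr => i _; rewrite mxE.
have P0 : P 0 = 0 by apply: big1 => i _; rewrite mxE scale0r.
split=> [/eigenvalueP[v vM v0]|[p p0 Ap]].
  by exists (P v); [rewrite -P0 (inj_eq P_inj)|rewrite PM vM PZ].
have [v pE] := P_surj p; apply/eigenvalueP; exists v.
  by apply: P_inj; rewrite -PM -PZ -pE.
by apply: contra_neq p0 => v0; rewrite pE v0.
Qed.

End Facts.

(* Main.v *)
From HB Require Import structures.
Require Import Defs.
From mathcomp Require Import all_boot all_order all_algebra.
From mathcomp Require Import qpoly complex ring.
From mathcomp Require Import all_classical all_reals all_analysis.
From mathcomp Require Import measurable_realfun.

(* Let Phi be the monic polynomial of degree n orthogonal to P_{n-1} in
   L^2(mu).  In the basis 1, z, ..., z^(n-1) the operator A^mu is the companion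
   matrix of Phi, so Phi is its characteristic polynomial.

   Uniqueness: running the Szego recursion backwards, Phi determines the monic
   orthogonal polynomials of all smaller degrees, hence all inner products
   <z^i, z^j> with i, j <= n.  If A^mu and A^nu have the same characteristic
   polynomial, the identity of P_{n-1} is therefore a unitary equivalence.

   Existence: for Phi = prod_i (z - z_i) take the Bernstein-Szego measure
   dmu = c |Phi|^-2 dtheta.  On the circle
   Phi z^-j / |Phi|^2 = z^(n-j) / prod_i (1 - conj(z_i) z), whose integral
   vanishes for j < n, so Phi is orthogonal to P_{n-1} in L^2(mu). *)

Set Implicit Arguments.
Unset Strict Implicit.
Unset Printing Implicit Defensive.

Import Order.TTheory GRing.Theory Num.Theory numFieldNormedType.Exports.
Local Open Scope ring_scope.

(** * Polynomials as vectors of L^2(mu) *)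

Section PolynomialInnerProduct.
Local Open Scope complex_scope.
Context {R : realType}.
Local Notation C := R[i].
Implicit Types (mu nu : probability (circle R) R) (p q : {poly C}).

Lemma circle_val_mulJ (z : circle R) : circle_val z * (circle_val z)^* = 1.
Proof.
have /set_mem := valP z; rewrite /unit_circle /= => zE.
by rewrite -sqr_normc [X in X ^+ 2](_ : _ = 1) ?expr1n.
Qed.

(** [poly_fun] without a degree bound, so that multiplication by z stays within one type; on
    [{poly_n C}] the two are convertible. *)
Definition circle_poly p : circle R -> C := fun z => p.[circle_val z].

Definition ip mu p q : C := inner mu (circle_poly p) (circle_poly q).

Lemma L2_circle_poly mu p : L2 mu (circle_poly p).
Proof.
exact: (L2_poly mu (NPoly (leqnn (size p) : p \is a poly_of_size _))).
Qed.
Hint Resolve L2_circle_poly : core.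

Lemma ipDl mu p1 p2 q : ip mu (p1 + p2) q = ip mu p1 q + ip mu p2 q.
Proof.
rewrite -innerDl//; congr inner; apply/funext => z.
by rewrite /circle_poly hornerD.
Qed.

Lemma ipZl mu (c : C) p q : ip mu (c *: p) q = c * ip mu p q.
Proof.
rewrite -innerZl//; congr inner; apply/funext => z.
by rewrite /circle_poly hornerZ.
Qed.

Lemma ipC mu p q : ip mu q p = (ip mu p q)^*.
Proof. exact: innerC. Qed.

Lemma ip0l mu q : ip mu 0 q = 0.
Proof. by rewrite -[0 in LHS](scale0r (0 : {poly C})) ipZl mul0r. Qed.

Lemma ipBl mu p1 p2 q : ip mu (p1 - p2) q = ip mu p1 q - ip mu p2 q.
Proof. by rewrite -scaleN1r ipDl ipZl mulN1r. Qed.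

Lemma ip_suml mu (I : Type) (r : seq I) (F : I -> {poly C}) q :
  ip mu (\sum_(i <- r) F i) q = \sum_(i <- r) ip mu (F i) q.
Proof. by elim/big_rec2: _ => [|i x p _ <-]; rewrite ?ip0l ?ipDl. Qed.

Lemma ip_polyl mu p q : ip mu p q = \sum_(i < size p) p`_i * ip mu 'X^i q.
Proof.
rewrite -{1}[p]coefK poly_def ip_suml.
by apply: eq_bigr => i _; rewrite ipZl.
Qed.

Lemma ip_polyr mu p q :
  ip mu p q = \sum_(j < size q) (q`_j)^* * ip mu p 'X^j.
Proof.
rewrite ipC ip_polyl rmorph_sum; apply: eq_bigr => j _.
by rewrite rmorphM; congr (_ * _); rewrite [RHS]ipC.
Qed.

(** Multiplication by z is an isometry of L^2(mu), because |z| = 1 on the circle. The Gram matrix of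
    the monomials is therefore Toeplitz. *)
Lemma ip_mulX mu p q : ip mu (p * 'X) (q * 'X) = ip mu p q.
Proof.
congr cintegral; apply/funext => z; rewrite /circle_poly !hornerMX rmorphM.
by rewrite mulrACA -/(circle_val z) [X in _ * X]circle_val_mulJ mulr1.
Qed.

Lemma ip_mulXn mu n p q : ip mu (p * 'X^n) (q * 'X^n) = ip mu p q.
Proof.
by elim: n => [|n ih]; rewrite ?expr0 ?mulr1// exprSr !mulrA ip_mulX.
Qed.

Lemma ip_eq0 mu p : nontrivial mu -> ip mu p p = 0 -> p = 0.
Proof.
move=> ntmu p0.
have sp : p \is a poly_of_size (size p) by exact: leqnn.
by have /(_ ntmu p0)/(congr1 (@polyn _ _)) :=
  @inner_poly_definite _ mu _ (NPoly sp).
Qed.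

Lemma ip1 mu : ip mu 1 1 = 1.
Proof.
rewrite /ip /inner (_ : (fun z => _) = cst 1); last first.
  by apply/funext => z; rewrite /circle_poly hornerC rmorph1 mulr1.
by rewrite /cintegral !Rintegral_cst//= probability_setT mul1r mul0r.
Qed.

(** * Monic orthogonal polynomials *)

(* OPUC: orthogonal polynomial on the unit circle. *)
Definition is_opuc mu n (Phi : {poly C}) : Prop :=
  [/\ Phi \is monic, size Phi = n.+1 &
      forall j, (j < n)%N -> ip mu Phi 'X^j = 0].

Lemma is_opuc_ip0 mu n Phi q : is_opuc mu n Phi -> (size q <= n)%N ->
  ip mu Phi q = 0.
Proof.
move=> [_ _ o] qn; rewrite ip_polyr big1// => j _.
by rewrite o ?mulr0// (leq_trans (ltn_ord j)).
Qed.

Lemma size_XnB_npoly n (r : {poly_n C}) : size ('X^n - (r : {poly C})) = n.+1.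
Proof. by rewrite size_polyDl ?size_polyXn// size_polyN ltnS size_npoly. Qed.

Lemma exists_opuc mu n : nontrivial mu -> exists Phi, is_opuc mu n Phi.
Proof.
move=> ntmu; set r := orth_proj mu n (circle_poly 'X^n).
exists ('X^n - (r : {poly C})); split.
- by rewrite monicE lead_coefDl ?lead_coefXn// size_polyN size_polyXn ltnS
    size_npoly.
- exact: size_XnB_npoly.
move=> j jn.
have Xjn : ('X^j : {poly C}) \is a poly_of_size n.
  by rewrite qualifE/= size_polyXn.
have rP := (orth_projP r ntmu (L2_circle_poly mu 'X^n)).1 erefl.
rewrite -[RHS](rP (NPoly Xjn)).
congr inner; apply/funext => z.
by rewrite /circle_poly hornerD hornerN.
Qed.

(** * The compressed operator as a companion matrix *)

Lemma orth_proj_poly mu n (p : {poly_n C}) : nontrivial mu ->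
  orth_proj mu n (poly_fun p) = p.
Proof.
move=> ntmu; apply/esym/orth_projP => // [|q]; first exact: L2_poly.
rewrite -[RHS](ip0l mu q); congr inner; apply/funext => z /=.
by rewrite subrr /circle_poly horner0.
Qed.

(** As [Phi] is orthogonal to P_{n-1}, splitting z p into [r] and a multiple of [Phi] exhibits [r]
    as the orthogonal projection of z p. *)
Lemma compressed_mult_opuc mu n Phi (p r : {poly_n C}) (c : C) :
  nontrivial mu -> is_opuc mu n Phi ->
  (p : {poly C}) * 'X = (r : {poly C}) + c *: Phi -> compressed_mult mu n p = r.
Proof.
move=> ntmu oPhi pr; rewrite compressed_multE// orth_proj_poly//.
have -> : mult_z (poly_fun p) = circle_poly ((p : {poly C}) * 'X)
    :> (circle R -> C).
  by apply/funext => z; rewrite /mult_z /circle_poly hornerMX mulrC.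
apply/esym/orth_projP => // q.
transitivity (ip mu (c *: Phi) q).
  congr inner; apply/funext => z /=; rewrite pr /circle_poly hornerD.
  by rewrite addrAC subrr add0r.
by rewrite ipZl (is_opuc_ip0 oPhi) ?mulr0// size_npoly.
Qed.

(** The projection of z p is its remainder modulo the monic [Phi]; z p has degree at most n, so the
    quotient is the top coefficient of [p]. *)
Lemma compressed_mult_opucE mu n Phi (p : {poly_n C}) :
  nontrivial mu -> is_opuc mu n Phi ->
  compressed_mult mu n p =
  npolyp n ((p : {poly C}) * 'X - (p : {poly C})`_n.-1 *: Phi).
Proof.
move=> ntmu oPhi; have [mPhi sPhi _] := oPhi.
apply: (compressed_mult_opuc (c := (p : {poly C})`_n.-1)) ntmu oPhi _.
rewrite npolypK ?subrK//; apply/leq_sizeP => j nj.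
rewrite coefB coefMX coefZ; case: n p sPhi nj => [|n] p sPhi nj.
  (* For [n = 0] the index [n.-1] is 0, but the space is zero and so is this coefficient. *)
  by rewrite !big_coef_npoly ?if_same ?mul0r ?subr0.
case: j nj => // j; rewrite leq_eqVlt => /predU1P[[<-]|nj].
  have := monicP mPhi; rewrite lead_coefE sPhi /= => ->.
  by rewrite mulr1 subrr.
rewrite (big_coef_npoly p (i := j.+1.-1))//.
by rewrite (nth_default 0 (s := Phi)) ?sPhi// mulr0 subrr.
Qed.

(** The operator sends z^i to z^(i+1) for i < n - 1, and z^(n-1) to z^n - Phi. Row by row this is
    [companionmx Phi]. *)
Lemma op_char_poly_opuc mu n Phi :
  nontrivial mu -> is_opuc mu n Phi ->
  op_char_poly (compressed_mult mu n) = Phi.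
Proof.
move=> ntmu oPhi; have [mPhi sPhi _] := oPhi.
rewrite -[RHS]companionmxK// /op_char_poly.
(* [companionmx Phi] has dimension [(size Phi).-1], which has to become [n] in its type before
   entries are compared. *)
move: (erefl (size Phi).-1); rewrite {2}sPhi/=.
rewrite /companionmx; move: (size Phi).-1 => m mn; subst m.
congr char_poly; apply/matrixP => i j; rewrite !mxE.
rewrite (compressed_mult_opucE _ ntmu oPhi) coef_npolyp ltn_ord.
rewrite (tnth_nth 0) nth_npolyX npolyXE -exprSr coefB coefZ !coefXn.
rewrite eq_sym [n.-1 == _]eq_sym.
have [->|_] := eqVneq (i : nat) n.-1; last by rewrite mul0r subr0.
rewrite mul1r prednK; last exact: leq_ltn_trans (ltn_ord j).
by rewrite gtn_eqF ?ltn_ord// sub0r.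
Qed.

(** * Reversed polynomials and the Szego recursion *)

(* The reversed polynomial, written Phi^* in the OPUC literature. *)
Definition rev_conj n p : {poly C} := \poly_(i < n.+1) (p`_(n - i))^*.

Lemma circle_val_expB n i (z : circle R) : (i <= n)%N ->
  circle_val z ^+ (n - i) = circle_val z ^+ n * (circle_val z ^+ i)^*.
Proof.
move=> ni; rewrite -{2}(subnK ni) exprD -mulrA rmorphXn -exprMn.
by rewrite circle_val_mulJ expr1n mulr1.
Qed.

Lemma circle_rev_conj n p (z : circle R) : (size p <= n.+1)%N ->
  (rev_conj n p).[circle_val z] = circle_val z ^+ n * (p.[circle_val z])^*.
Proof.
move=> pn; rewrite horner_poly (horner_coef_wide _ pn) rmorph_sum mulr_sumr.
rewrite (reindex_inj rev_ord_inj); apply: eq_bigr => i _ /=.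
rewrite subSS subKn; last by rewrite -ltnS.
rewrite rmorphM mulrCA; congr (_ * _).
by apply: circle_val_expB; rewrite -ltnS.
Qed.

(** On the circle p^* z^-j is the conjugate of p z^-(n-j). If [p] is the orthogonal polynomial of
    degree n, its reversal is thus orthogonal to z, ..., z^n. *)
Lemma ip_rev_conj mu n p j : (size p <= n.+1)%N -> (j <= n)%N ->
  ip mu (rev_conj n p) 'X^j = (ip mu p 'X^(n - j))^*.
Proof.
move=> pn jn; rewrite -ipC; congr cintegral; apply/funext => z.
rewrite /circle_poly circle_rev_conj// !hornerXn circle_val_expB//.
by rewrite mulrAC.
Qed.

(* The inverse Szego recursion. *)
Definition szego_down n (Phi : {poly C}) : {poly C} :=
  (1 - Phi`_0 * (Phi`_0)^*)^-1 *:
    \poly_(i < n.+1) (Phi - Phi`_0 *: rev_conj n.+1 Phi)`_i.+1.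

(** With a = Phi(0), the constant terms of Phi and a Phi^* agree, so G = Phi - a Phi^* is divisible
    by z. Both Phi and Phi^* are orthogonal to z, ..., z^n, hence P = G / z to 1, ..., z^(n-1). Its
    coefficient 1 - |a|^2 in degree n is nonzero and is divided out. *)
Lemma szego_downP mu n Phi : nontrivial mu -> is_opuc mu n.+1 Phi ->
  is_opuc mu n (szego_down n Phi).
Proof.
move=> ntmu oPhi; have [mPhi sPhi oX] := oPhi.
have Phi1 : Phi`_n.+1 = 1 by have := monicP mPhi; rewrite lead_coefE sPhi.
rewrite /szego_down; set a := Phi`_0; set G := Phi - _.
set P := \poly_(i < _) _.
have GP : G = P * 'X.
  apply/polyP => j; rewrite coefMX coef_poly.
  case: j => [|j] /=.
    by rewrite coefB coefZ coef_poly subn0 Phi1 rmorph1 mulr1 subrr.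
  case: ltnP => // nj; rewrite coefB coefZ coef_poly ltnS ltnNge nj /=.
  by rewrite mulr0 subr0 nth_default// sPhi.
have oP j : (j < n)%N -> ip mu P 'X^j = 0.
  move=> jn; rewrite -ip_mulX -GP -exprSr ipBl ipZl ip_rev_conj ?sPhi//;
    last exact: leqW.
  by rewrite !oX ?subn_ltn// ?conjc0 ?mulr0 ?subrr// ltnS// subSS leq_subr.
have Pn : P`_n = 1 - a * a^*.
  by rewrite coef_poly ltnSn coefB coefZ coef_poly ltnSn subnn Phi1.
(* If 1 - |a|^2 were 0, [P] would have degree below n and be orthogonal to itself, hence 0. Then Phi
   = a Phi^* would be orthogonal to z^(n+1) too, hence to itself, although it is nonzero. *)
have a1 : 1 - a * a^* != 0.
  apply/negP => /eqP a1; have : Phi != 0 by rewrite monic_neq0.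
  move=> /eqP; apply; apply: (ip_eq0 ntmu).
  have P0 : P = 0.
    apply: (ip_eq0 ntmu); rewrite ip_polyr big1// => j _.
    rewrite oP ?mulr0//; apply: leq_trans (ltn_ord j) _.
    apply/leq_sizeP => k; rewrite leq_eqVlt => /predU1P[<-|nk];
      first by rewrite Pn.
    by rewrite coef_poly ltnNge nk.
  have PhiE : Phi = a *: rev_conj n.+1 Phi.
    by apply/eqP; rewrite -subr_eq0 -/G GP P0 mul0r.
  rewrite ip_polyr big1// => j _; have := ltn_ord j;
    rewrite {2}sPhi ltnS leq_eqVlt.
  move=> /predU1P[->|jn]; last by rewrite oX// mulr0.
  by rewrite PhiE ipZl ip_rev_conj ?sPhi// subnn oX// conjc0 !mulr0.
have sP : size P = n.+1.
  apply/eqP; rewrite eqn_leq size_poly ltnNge.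
  apply: contra a1 => /leq_sizeP/(_ n (leqnn n)).
  by rewrite Pn => ->.
split.
- by rewrite monicE lead_coefZ lead_coefE sP Pn mulVf.
- by rewrite size_scale ?invr_eq0.
by move=> j jn; rewrite ipZl oP// mulr0.
Qed.

(** * Uniqueness up to unitary equivalence *)

(** [szego_down Phi] depends on [Phi] alone, so induction gives all inner products up to degree n.
    The moment of degree n + 1 follows from the orthogonality of the monic [Phi] to 1, the other
    inner products from the Toeplitz and Hermitian symmetries. *)
Lemma opuc_ip_eq mu nu n Phi : nontrivial mu -> nontrivial nu ->
  is_opuc mu n Phi -> is_opuc nu n Phi ->
  forall i j, (i <= n)%N -> (j <= n)%N -> ip mu 'X^i 'X^j = ip nu 'X^i 'X^j.
Proof.
move=> ntmu ntnu; elim: n Phi => [|n ih] Phi omu onu.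
  by move=> [|//] [|//] _ _; rewrite expr0 !ip1.
have {}ih := ih _ (szego_downP ntmu omu) (szego_downP ntnu onu).
have moment i : (i <= n.+1)%N -> ip mu 'X^i 1 = ip nu 'X^i 1.
  rewrite leq_eqVlt => /predU1P[->|]; last by move=> /ih/(_ (leq0n n));
    rewrite expr0.
  have [/monicP + sPhi /(_ 0%N isT)] := omu; have [_ _ /(_ 0%N isT)] := onu.
  rewrite lead_coefE sPhi /= => + Phi1.
  rewrite ip_polyl [in X in _ -> X -> _]ip_polyl sPhi.
  rewrite [in X in X -> _]big_ord_recr
    [in X in _ -> X -> _]big_ord_recr/= Phi1 !mul1r.
  move=> /eqP; rewrite addr_eq0 => /eqP nuE.
  move=> /eqP; rewrite addr_eq0 => /eqP muE.
  suff: ip mu 'X^(n.+1) 'X^0 = ip nu 'X^(n.+1) 'X^0 by rewrite expr0.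
  apply: oppr_inj; rewrite -muE -nuE; apply: eq_bigr => k _.
  by rewrite ih// -ltnS.
have le i j : (i <= n.+1)%N -> (j <= i)%N -> ip mu 'X^i 'X^j = ip nu 'X^i 'X^j.
  move=> i_n ji; rewrite -(subnK ji) exprD -{2 4}['X^j]mul1r !ip_mulXn.
  by rewrite moment// (leq_trans (leq_subr _ _)).
move=> i j i_n jn; have [ji|/ltnW ij] := leqP j i; first exact: le.
by rewrite ipC [RHS]ipC le.
Qed.

(** The identity is isometric by [opuc_ip_eq], and it intertwines the operators since
    [compressed_mult_opucE] writes both through [Phi] alone. *)
Lemma unitarily_equivalent_opuc mu nu n Phi : nontrivial mu -> nontrivial nu ->
  is_opuc mu n Phi -> is_opuc nu n Phi ->
  unitarily_equivalent mu nu (compressed_mult mu n) (compressed_mult nu n).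
Proof.
move=> ntmu ntnu omu onu; exists \1%VF; split.
- by exists id => p; rewrite lfunE.
- move=> p q; rewrite !lfunE /=.
  change (ip nu p q = ip mu p q).
  rewrite ip_polyr [RHS]ip_polyr; apply: eq_bigr => j _; congr (_ * _).
  rewrite ip_polyl [RHS]ip_polyl; apply: eq_bigr => i _; congr (_ * _).
  by apply/esym/(opuc_ip_eq ntmu ntnu omu onu);
    rewrite (leq_trans (ltnW (ltn_ord _)))// size_npoly.
apply/lfunP => p; rewrite !comp_lfunE !lfunE /=.
rewrite (compressed_mult_opucE _ ntmu omu).
by rewrite (compressed_mult_opucE _ ntnu onu).
Qed.

Lemma unitarily_equivalent_char_poly mu nu n : nontrivial mu -> nontrivial nu ->
  op_char_poly (compressed_mult mu n) = op_char_poly (compressed_mult nu n) ->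
  unitarily_equivalent mu nu (compressed_mult mu n) (compressed_mult nu n).
Proof.
move=> ntmu ntnu.
have [Phi omu] := exists_opuc n ntmu; have [Psi onu] := exists_opuc n ntnu.
rewrite (op_char_poly_opuc ntmu omu) (op_char_poly_opuc ntnu onu) => PhiPsi.
rewrite PhiPsi in omu; exact: unitarily_equivalent_opuc omu onu.
Qed.

End PolynomialInnerProduct.

(** * Probability measures given by a density *)

Section RealMeasure.
Local Open Scope classical_set_scope.

(** [Q] is the measure w dP. Its Radon-Nikodym derivative has the same integral as [w] over every
    measurable set, so it equals [w] almost everywhere. *)
Lemma probability_density d (T : measurableType d) (R : realType)
    (P : probability T R) (w : T -> R) :
  P.-integrable setT (EFin \o w) -> (forall x, 0 <= w x) ->
  (\int[P]_x (w x)%:E = 1)%E ->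
  exists Q : probability T R, Q `<< P /\
    forall f : T -> R, Q.-integrable setT (EFin \o f) ->
      \int[Q]_x f x = \int[P]_x (f x * w x).
Proof.
move=> iw w0 w1.
have mw : measurable_fun setT (EFin \o w) by case/integrableP: iw.
pose q A := (\int[P]_(x in A) (w x)%:E)%E.
have q0 : q set0 = 0%E by rewrite /q integral_set0.
have q_ge0 A : (0 <= q A)%E by apply: integral_ge0 => x _; rewrite lee_fin.
have q_add : semi_sigma_additive q.
  by apply: semi_sigma_additive_nng_induced => // x; rewrite lee_fin.
pose Qm := isMeasure.Build _ _ _ q q0 q_ge0 q_add.
pose qm : {measure set T -> \bar R} := HB.pack q Qm.
pose Qp := Measure_isProbability.Build _ _ _ qm w1.
pose Q : probability T R := HB.pack_for (probability T R) q Qm Qp.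
have QP : Q `<< P.
  apply/null_content_dominatesP => A mA PA.
  by rewrite [LHS]null_set_integral//; exact: measurable_funTS.
exists Q; split => // f intf; congr fine.
rewrite -(Radon_Nikodym_change_of_variables QP)//.
have mf : measurable_fun setT (EFin \o f) by case/integrableP: intf.
apply: ae_eq_integral => //; first exact: emeasurable_funM.
  by apply/measurable_EFinP; apply: measurable_funM; exact/measurable_EFinP.
suff: ae_eq P setT (Radon_Nikodym (charge_of_finite_measure Q) P) (EFin \o w).
  by apply: filterS => x /= /[apply] ->.
apply: integral_ae_eq => //.
  exact: Radon_Nikodym_integrable.
by move=> A _ mA; rewrite -Radon_Nikodym_integral.
Qed.

Lemma measurable_funV d (T : measurableType d) (R : realType) (f : T -> R) :
  measurable_fun setT f -> (forall x, 0 <= f x) ->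
  measurable_fun setT (fun x => (f x)^-1).
Proof.
move=> mf f0; rewrite (_ : (fun _ => _) = (@powR R ^~ (-1)) \o f).
  by apply: measurableT_comp => //; exact: measurable_powR.
by apply/funext => x /=; rewrite powR_inv1.
Qed.

Lemma bounded_integrable d (T : measurableType d) (R : realType)
    (P : probability T R) (f : T -> R) (M : R) :
  measurable_fun setT f -> (forall x, `|f x| <= M) ->
  P.-integrable setT (EFin \o f).
Proof.
move=> mf fM; apply: measurable_bounded_integrable => //.
  by rewrite ltey_eq fin_num_measure.
by exists M; split; rewrite ?num_real// => N MN z _; exact: le_trans (ltW MN).
Qed.

End RealMeasure.

(** * Normalised arc length on the circle *)

Section BernsteinSzego.
Local Open Scope classical_set_scope.
Local Open Scope complex_scope.
Context {R : realType}.
Local Notation C := R[i].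
Local Notation Re := (@complex.Re R).
Local Notation Im := (@complex.Im R).

Lemma unit_circle_cos_sin (t : R) : unit_circle R (cos t +i* sin t).
Proof. by rewrite /unit_circle /= normc_def /= cos2Dsin2 sqrtr1. Qed.

Definition circle_exp (t : R) : circle R :=
  exist _ (cos t +i* sin t) (mem_set (unit_circle_cos_sin t)).

Lemma measurable_circle_exp :
  measurable_fun (setT : set (measurableTypeR R)) circle_exp.
Proof.
apply: (@measurability _ _ _ _ setT circle_exp
  (@open (set_type (unit_circle R))) erefl) => _ [_ [U oU <-] <-].
rewrite setTI; apply: open_measurable; rewrite openE => t /= Ut; apply/nbhs_ballP.
have [e e0 eU] : exists2 e : R, 0 < e &
    forall s, `|cos t - cos s| < e -> `|sin t - sin s| < e ->
      U (cos s +i* sin s).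
  move: oU; rewrite openE => /(_ _ Ut) /nbhs_ballP [[e e'] /=].
  rewrite ltcE /= => /andP[/eqP -> e0] eU.
  (* Half the radius [e] for each part, as |x + iy| <= |x| + |y|. *)
  exists (e / 2) => [|s cts sts]; first by rewrite divr_gt0.
  apply: eU; rewrite /ball /= [_ - _]complexE.
  apply: (le_lt_trans (ler_normD _ _)).
  rewrite normrM !normc_def /= !expr0n /= expr1n add0r !addr0 sqrtr1 mul1r.
  rewrite !sqrtr_sqr -rmorphD ltcR.
  by rewrite [e]splitr ltrD.
have /cvgr_dist_lt/(_ _ e0) ct := @continuous_cos R t.
have /cvgr_dist_lt/(_ _ e0) st := @continuous_sin R t.
have /nbhs_ballP[d d0 dU] : \forall s \near t, U (cos s +i* sin s).
  by near=> s; apply: eU; near: s.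
by exists d.
Unshelve. all: by end_near. Qed.

Definition circle_exp_mfun : {mfun measurableTypeR R >-> circle R} :=
  HB.pack_for {mfun measurableTypeR R >-> circle R} circle_exp
    (isMeasurableFun.Build _ _ (measurableTypeR R) (circle R) _
      measurable_circle_exp).

Lemma ltNpipi : - pi < pi :> R.
Proof. by rewrite gt0_cp ?pi_gt0. Qed.

(** The measure dtheta / (2 pi), carried over from [-pi, pi]. *)
Definition uniform_circle : probability (circle R) R :=
  distribution (uniform_prob ltNpipi) circle_exp_mfun.

Local Notation lambda := uniform_circle.

(** An angle in [-pi, pi] is plus or minus the [acos] of the real part of its image, so finite sets
    have finite preimages there, which are Lebesgue null. *)
Lemma uniform_circle_finite (F : set (circle R)) : finite_set F ->
  measurable F -> uniform_circle F = 0%E.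
Proof.
move=> finF mF; rewrite /uniform_circle /distribution /pushforward /=.
set A := _ @^-1` _.
have mA : measurable A by rewrite -[A]setTI; exact: measurable_circle_exp.
rewrite /uniform_prob integral_uniform_pdf; apply: null_set_integral.
- exact: measurableI.
- by apply/measurable_EFinP/measurable_funTS; exact: measurable_uniform_pdf.
apply: countable_lebesgue_measure0; apply: finite_set_countable.
pose f (z : circle R) := acos (complex.Re (circle_val z)).
apply: (@sub_finite_set _ _ ((f @` F) `|` ((fun z => - f z) @` F))); last first.
  by rewrite finite_setU; split; exact: finite_image.
move=> t [Ft] /=; rewrite in_itv /= => /andP[Npit tpi].
have [t0|t0] := leP 0 t.
  by left; exists (circle_exp t) => //; rewrite /f /= cosK// in_itv /= t0.
right; exists (circle_exp t) => //; rewrite /f /= -cosN cosK ?opprK// in_itv /=.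
by rewrite oppr_ge0 lerNl (ltW t0).
Qed.

Lemma Rintegral_uniform_circle0 (g : circle R -> R) (G : R -> R) :
  measurable_fun setT g -> (forall z, `|g z| <= 1) ->
  (forall t : R, is_derive t (1 : R) G (g (circle_exp t))) ->
  continuous (g \o circle_exp : R -> R) -> G (- pi) = G pi ->
  \int[uniform_circle]_z g z = 0.
Proof.
move=> mg g1 dG cg GpiE.
have ig : uniform_circle.-integrable setT (EFin \o g).
  exact: bounded_integrable g1.
have i1 : uniform_circle.-integrable setT (EFin \o cst 1).
  by apply: (@bounded_integrable _ _ _ _ _ 1) => // z; rewrite normr1.
(* The transfer to [-pi, pi] is made for the nonnegative 1 + g. Its primitive t + G t grows by 2 pi
   over the interval, so the mean is 1. *)
apply: (@addrI _ 1); rewrite addr0.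
rewrite -{1}[1](_ : \int[uniform_circle]_z cst 1 z = 1); last first.
  rewrite Rintegral_cst//=.
  by rewrite probability_setT mulr1.
rewrite -RintegralD// /Rintegral ge0_integral_distribution; last 2 first.
- by apply/measurable_EFinP; exact: measurable_funD.
- by move=> z; rewrite lee_fin -lerBlDl sub0r; have := g1 z;
    rewrite ler_norml => /andP[].
rewrite integral_uniform; last 2 first.
- apply/measurable_EFinP; apply: measurable_funD => //.
  exact: measurableT_comp mg measurable_circle_exp.
- by move=> t; rewrite lee_fin -lerBlDl sub0r; have := g1 (circle_exp t);
    rewrite ler_norml => /andP[].
have dH (t : R) : is_derive t (1 : R) (fun s => s + G s) (1 + g (circle_exp t)).
  by apply: is_deriveD.
have cH : continuous (fun t : R => 1 + g (circle_exp t)).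
  by move=> t; apply: cvgD; [exact: cvg_cst|exact: cg].
have cHG : continuous (fun s : R => s + G s).
  by move=> t; apply: differentiable_continuous; apply/derivable1_diffP;
    apply: ex_derive.
rewrite (@continuous_FTC2 _ _ (fun t => t + G t))//.
- rewrite GpiE -EFinB -EFinM (_ : forall p q x : R, p + x - (q + x) = p - q)//;
    last by move=> p q x; ring.
  rewrite mulVf//.
  by rewrite gt_eqF// subr_gt0 ltNpipi.
- exact: ltNpipi.
- exact: continuous_subspaceT.
- split.
  + by move=> t _; apply: ex_derive.
  + exact/cvg_at_right_filter/cHG.
  + exact/cvg_at_left_filter/cHG.
by move=> t _; rewrite derive1E; apply: derive_val.
Qed.

Lemma circle_expXn k t :
  circle_val (circle_exp t) ^+ k = cos (t *+ k) +i* sin (t *+ k).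
Proof.
elim: k => [|k ih]; first by rewrite expr0 mulr0n cos0 sin0.
rewrite exprSr ih mulrSr cosD sinD /circle_val /=.
by congr (_ +i* _); rewrite addrC.
Qed.

(** * Bounded measurable functions on the circle *)

Lemma norm_circle_val (z : circle R) : `|circle_val z| = 1.
Proof. by have /set_mem := valP z. Qed.

(** A class closed under sums, products, conjugation and inversion away from 0, and contained in
    L^2(mu) for every probability [mu]; it settles the integrability of the integrands below. *)
Definition bounded_measurable (f : circle R -> C) :=
  [/\ measurable_fun setT (fun z => Re (f z)),
      measurable_fun setT (fun z => Im (f z)) &
      exists M : R, forall z, `|f z| <= M%:C].

Lemma norm_Re_le (x : C) (M : R) : `|x| <= M%:C -> `|Re x| <= M.
Proof. by move=> xM; rewrite -lecR (le_trans _ xM)// normc_ge_Re. Qed.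

Lemma norm_Im_le (x : C) (M : R) : `|x| <= M%:C -> `|Im x| <= M.
Proof.
move=> xM; rewrite -normrN -ReiNIm norm_Re_le// normrM (_ : `|'i| = 1) ?mulr1//.
by rewrite normc_def /= expr0n /= expr1n add0r sqrtr1.
Qed.

Lemma bounded_measurable_cst (c : C) : bounded_measurable (fun=> c).
Proof.
split; [exact: measurable_cst..|].
by exists (Re `|c|) => z; rewrite normc_def lexx.
Qed.

Lemma bounded_measurable_circle_val : bounded_measurable (@circle_val R).
Proof.
split; [exact: measurable_Re_circle|exact: measurable_Im_circle|].
by exists 1 => z; rewrite norm_circle_val.
Qed.

Lemma bounded_measurableD f g : bounded_measurable f -> bounded_measurable g ->
  bounded_measurable (fun z => f z + g z).
Proof.
move=> [fr fi [M fM]] [gr gi [N gN]]; split.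
- rewrite (_ : (fun _ => _) = (fun z => Re (f z)) \+ (fun z => Re (g z))).
    exact: measurable_funD.
  by apply/funext => z /=; case: (f z) (g z) => ? ? [].
- rewrite (_ : (fun _ => _) = (fun z => Im (f z)) \+ (fun z => Im (g z))).
    exact: measurable_funD.
  by apply/funext => z /=; case: (f z) (g z) => ? ? [].
by exists (M + N) => z; rewrite rmorphD (le_trans (ler_normD _ _))// lerD.
Qed.

Lemma bounded_measurableM f g : bounded_measurable f -> bounded_measurable g ->
  bounded_measurable (fun z => f z * g z).
Proof.
move=> [fr fi [M fM]] [gr gi [N gN]]; split.
- rewrite (_ : (fun _ => _) = (fun z => Re (f z)) \* (fun z => Re (g z)) \-
    (fun z => Im (f z)) \* (fun z => Im (g z))).
    by apply: measurable_funB; exact: measurable_funM.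
  by apply/funext => z /=; case: (f z) (g z) => ? ? [].
- rewrite (_ : (fun _ => _) = (fun z => Re (f z)) \* (fun z => Im (g z)) \+
    (fun z => Im (f z)) \* (fun z => Re (g z))).
    by apply: measurable_funD; exact: measurable_funM.
  by apply/funext => z /=; case: (f z) (g z) => ? ? [].
by exists (M * N) => z; rewrite rmorphM normrM ler_pM.
Qed.

Lemma bounded_measurableV f (m : R) : bounded_measurable f -> 0 < m ->
  (forall z, m%:C <= `|f z|) -> bounded_measurable (fun z => (f z)^-1).
Proof.
move=> [fr fi _] m0 fm.
have msq : measurable_fun setT (fun z => (Re (f z) ^+ 2 + Im (f z) ^+ 2)^-1).
  apply: measurable_funV => [|z]; last by rewrite addr_ge0 ?sqr_ge0.
  by apply: measurable_funD; exact: measurable_funX.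
split.
- rewrite (_ : (fun _ => _) =
    (fun z => Re (f z)) \* (fun z => (Re (f z) ^+ 2 + Im (f z) ^+ 2)^-1)).
    exact: measurable_funM.
  by apply/funext => z /=; case: (f z).
- rewrite (_ : (fun _ => _) = (fun z => - Im (f z)) \*
    (fun z => (Re (f z) ^+ 2 + Im (f z) ^+ 2)^-1)).
    by apply: measurable_funM => //; exact: measurableT_comp.
  by apply/funext => z /=; case: (f z) => a b /=; rewrite mulNr.
have m0' : 0 < m%:C by rewrite ltcE /= eqxx.
exists m^-1 => z; rewrite normfV fmorphV lef_pV2 ?posrE//.
exact: lt_le_trans (fm z).
Qed.

Lemma bounded_measurable_poly p : bounded_measurable (circle_poly p).
Proof.
rewrite /circle_poly; elim/poly_ind: p => [|p c ih].
  by under [X in bounded_measurable X]eq_fun do rewrite horner0;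
    exact: bounded_measurable_cst.
under [X in bounded_measurable X]eq_fun do rewrite hornerMXaddC.
apply: bounded_measurableD; last exact: bounded_measurable_cst.
by apply: bounded_measurableM => //; exact: bounded_measurable_circle_val.
Qed.

Lemma bounded_measurable_integrable (mu : probability (circle R) R) f :
  bounded_measurable f -> mu.-integrable setT (EFin \o (fun z => Re (f z))) /\
    mu.-integrable setT (EFin \o (fun z => Im (f z))).
Proof.
move=> [fr fi [M fM]].
split; apply: (@bounded_integrable _ _ _ _ _ M) => // z.
  exact: norm_Re_le.
exact: norm_Im_le.
Qed.

Lemma bounded_measurable_L2 (mu : probability (circle R) R) f :
  bounded_measurable f -> L2 mu f.
Proof.
move=> [fr fi [M fM]]; split => //.
apply: (@bounded_integrable _ _ _ _ (fun z => Re (f z) ^+ 2 + Im (f z) ^+ 2)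
  (M ^+ 2)).
  by apply: measurable_funD; exact: measurable_funX.
move=> z; rewrite ger0_norm ?addr_ge0 ?sqr_ge0// -lecR add_Re2_Im2 rmorphXn.
by rewrite lerXn2r ?nnegrE// (le_trans _ (fM z)).
Qed.

Lemma cintegral_norm_le (mu : probability (circle R) R) f (M : R) :
  bounded_measurable f -> (forall z, `|f z| <= M%:C) ->
  `|cintegral mu f| <= (M + M)%:C.
Proof.
move=> bf fM; have [ir ii] := bounded_measurable_integrable mu bf.
have le g : mu.-integrable setT (EFin \o g) -> (forall z, `|g z| <= M) ->
    `|\int[mu]_z g z| <= M.
  move=> ig gM; rewrite (le_trans (le_normr_Rintegral _ _))//.
  rewrite (le_trans (le_Rintegral (f2 := cst M) _ _ _ _))//.
  - exact: integrable_norm.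
  - by apply: (@bounded_integrable _ _ _ _ _ `|M|).
  - by rewrite Rintegral_cst//= probability_setT mulr1.
rewrite /cintegral [X in `|X|]complexE (le_trans (ler_normD _ _))//.
rewrite normrM !normc_def /= !expr0n /= expr1n add0r !addr0 sqrtr1 mul1r.
rewrite !sqrtr_sqr -rmorphD lecR lerD// le// => z; first exact: norm_Re_le.
exact: norm_Im_le.
Qed.

(** * Vanishing integrals against arc length *)

Lemma sin_pimuln k : sin (pi *+ k) = 0 :> R.
Proof.
elim: k => [|k ih]; first by rewrite mulr0n sin0.
by rewrite mulrSr sinD ih sinpi mulr0 mul0r addr0.
Qed.

(** At angle t, z^k is cos kt + i sin kt, with primitives sin(kt)/k and -cos(kt)/k that agree at -pi
    and pi. *)
Lemma uniform_circle_moment k : (0 < k)%N -> ip lambda 'X^k 1 = 0.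
Proof.
move=> k0; have kR : k%:R != 0 :> R by rewrite pnatr_eq0 -lt0n.
have bk := bounded_measurable_poly 'X^k; have [mr mi _] := bk.
have kE t :
    circle_poly 'X^k (circle_exp t) = cos (k%:R * t) +i* sin (k%:R * t) :> C.
  by rewrite /circle_poly hornerXn circle_expXn mulr_natl.
have k1 z : `|circle_poly 'X^k z| <= (1 : R)%:C.
  by rewrite /circle_poly hornerXn normrX norm_circle_val expr1n.
have dk (t : R) : is_derive t (1 : R) ( *%R k%:R) k%:R.
  by rewrite -[X in is_derive _ _ _ X]mulr1; exact: is_deriveZ.
have ck : continuous ( *%R k%:R : R -> R) by exact: mulrl_continuous.
rewrite /ip /inner (_ : (fun z => _) = circle_poly 'X^k); last first.
  by apply/funext => z; rewrite {2}/circle_poly hornerC rmorph1 mulr1.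
congr (_ +i* _).
  apply: (@Rintegral_uniform_circle0 _ (k%:R^-1 \*: (@sin R \o *%R k%:R)))
    => //.
  - by move=> z; exact: norm_Re_le.
  - move=> t; rewrite kE /=.
    rewrite (_ : cos _ = k%:R^-1 *: (cos (k%:R * t) * k%:R)).
      exact: is_deriveZ.
    by rewrite /GRing.scale /=; field.
  - rewrite (_ : _ \o _ = cos \o *%R k%:R); last first.
      by apply/funext => t /=; rewrite kE.
    by move=> t; apply: continuous_comp; [exact: ck|exact: continuous_cos].
  - by rewrite /= mulrN sinN mulr_natl sin_pimuln oppr0.
apply: (@Rintegral_uniform_circle0 _ (- k%:R^-1 \*: (@cos R \o *%R k%:R)))
  => //.
- by move=> z; exact: norm_Im_le.
- move=> t; rewrite kE /=.
  rewrite (_ : sin _ = - k%:R^-1 *: (- sin (k%:R * t) * k%:R)).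
    exact: is_deriveZ.
  by rewrite /GRing.scale /=; field.
- rewrite (_ : _ \o _ = sin \o *%R k%:R); last first.
    by apply/funext => t /=; rewrite kE.
  by move=> t; apply: continuous_comp; [exact: ck|exact: continuous_sin].
- by rewrite /= mulrN cosN.
Qed.

Lemma bounded_measurable_exp_circle_val k :
  bounded_measurable (fun z : circle R => circle_val z ^+ k).
Proof.
rewrite (_ : (fun _ => _) = circle_poly 'X^k).
  exact: bounded_measurable_poly.
by apply/funext => z; rewrite /circle_poly hornerXn.
Qed.

Lemma le_norm_1subM (a : C) (z : circle R) :
  1 - `|a| <= `|1 - a * circle_val z|.
Proof.
by rewrite (le_trans _ (lerB_dist _ _))// normr1 normrM norm_circle_val mulr1.
Qed.

(** For [s] the conjugates of the zeros of Phi this is 1 / Phi^*, whose poles lie outside the closed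
    disc when those zeros lie in the open disc. *)
Definition pole_fun (s : seq C) (z : circle R) : C :=
  \prod_(a <- s) (1 - a * circle_val z)^-1.

Lemma bounded_measurable_pole s : all (fun a => `|a| < 1) s ->
  bounded_measurable (pole_fun s).
Proof.
rewrite /pole_fun; elim: s => [_|a s ih /= /andP[a1 /ih {}ih]].
  under [X in bounded_measurable X]eq_fun do rewrite big_nil.
  exact: bounded_measurable_cst.
under [X in bounded_measurable X]eq_fun do rewrite big_cons.
apply: bounded_measurableM => //.
have a1' : 1 - `|a| = (1 - Re `|a|)%:C.
  by rewrite rmorphB normc_def.
apply: (@bounded_measurableV _ (1 - Re `|a|)).
- have := bounded_measurable_poly (1 - a *: 'X); congr bounded_measurable.
  apply/funext => z; rewrite /circle_poly hornerD hornerN hornerZ hornerX.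
  by rewrite hornerC.
- by rewrite subr_gt0; move: a1; rewrite normc_def /= ltcE => /andP[].
- by move=> z; rewrite -a1' le_norm_1subM.
Qed.

(* With [I s k] the integral below,
   [I s k = I (a :: s) k - a * I (a :: s) k.+1], so if [I s] vanishes then
   [I (a :: s) k = a ^+ N * I (a :: s) (k + N)] for all [N], and [I (a :: s)]
   is bounded. *)
Lemma cintegral_pole s k : all (fun a => `|a| < 1) s -> (0 < k)%N ->
  cintegral lambda (fun z => circle_val z ^+ k * pole_fun s z) = 0.
Proof.
elim: s k => [k _ k0|a s ih k /= /andP[a1 sP] k0].
  rewrite -(uniform_circle_moment k0); congr cintegral; apply/funext => z.
  by rewrite /pole_fun big_nil /circle_poly hornerXn hornerC rmorph1.
have asP : all (fun a => `|a| < 1) (a :: s) by rewrite /= a1.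
have bI j :
    bounded_measurable (fun z => circle_val z ^+ j * pole_fun (a :: s) z).
  apply: bounded_measurableM; last exact: bounded_measurable_pole.
  exact: bounded_measurable_exp_circle_val.
pose I j := cintegral lambda (fun z => circle_val z ^+ j * pole_fun (a :: s) z).
(* Pairing with the constant 1 makes the linearity lemmas for [inner] available. *)
have I_inner j : I j =
    inner lambda (fun z => circle_val z ^+ j * pole_fun (a :: s) z) (fun=> 1).
  by congr cintegral; apply/funext => z; rewrite rmorph1 mulr1.
have L2I j := bounded_measurable_L2 lambda (bI j).
have L21 : L2 lambda (fun=> 1).
  exact/bounded_measurable_L2/bounded_measurable_cst.
have IS j : (0 < j)%N -> I j = a * I j.+1.
  move=> j0; apply/eqP; rewrite -subr_eq0 -mulNr !I_inner -innerZl// -innerDl//;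
    last exact: L2Z.
  apply/eqP; rewrite -(ih _ sP j0); congr cintegral; apply/funext => z.
  rewrite rmorph1 mulr1 /pole_fun !big_cons exprSr.
  have : 1 - a * circle_val z != 0.
    by rewrite -normr_gt0 (lt_le_trans _ (le_norm_1subM _ _))// subr_gt0.
  set p := \prod_(_ <- _) _; set x := circle_val z; move: p x => p x xa.
  by field.
have IN N : I k = a ^+ N * I (k + N)%N.
  elim: N => [|N IN]; first by rewrite expr0 addn0 mul1r.
  by rewrite IN IS ?addn_gt0 ?k0// addnS exprSr mulrA.
have [_ _ [M pM]] := bounded_measurable_pole asP.
have IM j : `|I j| <= (M + M)%:C.
  apply: cintegral_norm_le => // z.
  by rewrite normrM normrX norm_circle_val expr1n mul1r.
(* The norm is complex-valued; [x] is its real value, bounded by 2M |a|^N for every N, and the limit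
   is taken in [R]. *)
apply/eqP; rewrite -normr_eq0 normc_def; set x := Num.sqrt _.
suff : x <= 0.
  by rewrite le_eqVlt ltNge sqrtr_ge0 orbF => /eqP ->.
have x_le N : x <= (M + M) * (Re `|a|) ^+ N.
  rewrite -lecR (_ : x%:C = `|I k|); last by rewrite normc_def.
  rewrite (IN N) normrM mulrC rmorphM rmorphXn normrX.
  rewrite [X in _ <= _ * X ^+ N](_ : _ = `|a|); last by rewrite normc_def.
  by apply: ler_pM => //; rewrite exprn_ge0.
have r1 : `|Re `|a| | < 1.
  move: a1; rewrite normc_def ltcE => /andP[_] /=.
  by rewrite ger0_norm// sqrtr_ge0.
have cv := cvg_geometric (M + M) r1.
by apply: (cvgr_to_ge cv); apply: nearW => N; exact: x_le.
Qed.

Lemma bounded_measurableJ (f : circle R -> C) :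
  bounded_measurable f -> bounded_measurable (fun z => (f z)^*).
Proof.
move=> [fr fi [M fM]]; split.
- rewrite (_ : (fun _ => _) = (fun z => Re (f z))) //.
  by apply/funext => z; case: (f z).
- rewrite (_ : (fun _ => _) = \- (fun z => Im (f z))).
    exact: measurableT_comp.
  by apply/funext => z /=; case: (f z).
by exists M => z; rewrite norm_conjC.
Qed.

(** * The Bernstein-Szego measure *)

(** Finite sets are null for [lambda], hence for [mu]; one with a null complement would make the
    total mass 0. *)
Lemma dominated_nontrivial (mu : probability (circle R) R) :
  mu `<< lambda -> nontrivial mu.
Proof.
move=> mu_lambda [F [finF muF]].
have mF : measurable F.
  rewrite (_ : F = \bigcup_(a in F) [set a]); last first.
    by apply/seteqP; split => [x Fx|x [_ Fa ->//]]; exists x.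
  apply: fin_bigcup_measurable => // a _.
  rewrite (_ : [set a] =
      (fun z => Re (circle_val z)) @^-1` [set Re (circle_val a)] `&`
      (fun z => Im (circle_val z)) @^-1` [set Im (circle_val a)]).
    by apply: measurableI; rewrite -[X in measurable X]setTI;
      [exact: measurable_Re_circle|exact: measurable_Im_circle].
  apply/seteqP; split => [_ ->//|x [xRe xIm]]; apply: val_inj.
  by apply/eqP; rewrite eq_complex; apply/andP; split; apply/eqP.
have mu0 : mu F = 0%E.
  move/null_content_dominatesP : mu_lambda; apply => //.
  exact: uniform_circle_finite.
have muU : mu (F `|` ~` F) = (mu F + mu (~` F))%E.
  by apply: measureU => //; [exact: measurableC|rewrite setICr].
have := @probability_setT _ _ _ mu.
by rewrite -(setUv F) muU mu0 muF adde0 => /eqP; rewrite eq_sym onee_eq0.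
Qed.

Lemma bernstein_szego n (z : 'I_n -> C) : (forall i, `|z i| < 1) ->
  exists mu : probability (circle R) R,
    nontrivial mu /\ is_opuc mu n (\prod_(i < n) ('X - (z i)%:P)).
Proof.
move=> z1; set Phi := \prod_(i < n) _.
pose s := [seq (z i)^* | i <- enum 'I_n].
have sP : all (fun a => `|a| < 1) s.
  by apply/allP => _ /mapP[i _ ->]; rewrite norm_conjC.
have bp := bounded_measurable_pole sP; have [pr pi _] := bp.
set p := pole_fun s in bp pr pi.
have pE x : p x = \prod_(i < n) (1 - (z i)^* * circle_val x)^-1.
  by rewrite /p /pole_fun big_map big_enum.
(* On the circle x - z_i is x times the conjugate of 1 - conj(z_i) x. Consequently |p|^2 = |Phi|^-2,
   which is the density [w0] before normalisation. *)
have PhiE x : circle_poly Phi x * (p x)^* = circle_val x ^+ n.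
  rewrite /circle_poly horner_prod pE rmorph_prod -big_split /=.
  rewrite (eq_bigr (fun=> circle_val x)) ?prodr_const ?card_ord// => i _.
  rewrite hornerXsubC fmorphV rmorphB rmorph1 rmorphM [X in _ - X * _]conjcK.
  have xJ := circle_val_mulJ x.
  have xz : circle_val x - z i != 0.
    apply: contraTneq (z1 i) => /eqP; rewrite subr_eq0 => /eqP <-.
    by rewrite norm_circle_val ltxx.
  have xzE : circle_val x - z i = circle_val x * (1 - z i * (circle_val x)^*).
    by rewrite mulrBr mulr1 mulrCA xJ mulr1.
  rewrite xzE mulfK//; apply: contraNneq xz => t0.
  by rewrite xzE t0 mulr0.
pose w0 x := Re (p x) ^+ 2 + Im (p x) ^+ 2.
have [_ _ iw0] := bounded_measurable_L2 lambda bp.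
have iZ k : lambda.-integrable setT (EFin \o (fun x => k * w0 x)).
  by have := integrableZl measurableT k iw0; apply: eq_integrable.
pose c := \int[lambda]_x w0 x.
(* The reciprocal [q] of [p] is bounded by some M on the circle, so 1 = |q p|^2 <= M^2 [w0];
   integrating, 1 <= M^2 c. *)
have c0 : 0 < c.
  pose q : {poly C} := \prod_(i < n) (1 - (z i)^* *: 'X).
  have [_ _ [M qM]] := bounded_measurable_poly q.
  have qp x : circle_poly q x * p x = 1.
    rewrite /circle_poly horner_prod pE -big_split big1//= => i _.
    rewrite hornerD hornerN hornerZ hornerX hornerC mulfV//.
    rewrite -normr_gt0 (lt_le_trans _ (le_norm_1subM _ _))// subr_gt0.
    by rewrite norm_conjC.
  rewrite ltNge; apply/negP => c_le0.
  suff : 1 <= M ^+ 2 * c.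
    by apply/negP; rewrite -ltNge (le_lt_trans _ ltr01)// mulr_ge0_le0 ?sqr_ge0.
  rewrite -RintegralZl// -[leLHS](_ : \int[lambda]_x cst 1 x = 1); last first.
    by rewrite Rintegral_cst//= probability_setT mulr1.
  apply: le_Rintegral => //.
    by apply: (@bounded_integrable _ _ _ _ _ 1) => // x; rewrite normr1.
  move=> x _; rewrite -lecR rmorphM rmorphXn /w0 /= add_Re2_Im2 -exprMn.
  rewrite [leLHS](_ : _ = (1 : C) ^+ 2); last by rewrite expr1n.
  rewrite lerXn2r ?nnegrE//.
    by rewrite mulr_ge0// (le_trans _ (qM x)).
  by rewrite -[leLHS]normr1 -(qp x) normrM ler_wpM2r.
have [||mu [mu_lambda muE]] := probability_density (iZ c^-1).
- by move=> x; rewrite mulr_ge0 ?invr_ge0 ?(ltW c0)// addr_ge0 ?sqr_ge0.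
- rewrite -[LHS]fineK; last exact: integrable_fin_num (iZ c^-1).
  by rewrite -/(Rintegral _ _ _) RintegralZl// mulVf// gt_eqF.
exists mu; split; first exact: dominated_nontrivial.
split.
- exact: monic_prod_XsubC.
- by rewrite size_prod_XsubC [index_enum _]unlock -enumT size_enum_ord.
move=> j jn.
have bX k := bounded_measurable_exp_circle_val k.
pose f x := circle_poly Phi x * (circle_poly 'X^j x)^* : C.
have bf : bounded_measurable f.
  by apply: bounded_measurableM; first exact: bounded_measurable_poly;
    apply: bounded_measurableJ; exact: bounded_measurable_poly.
(* By [PhiE], Phi z^-j |p|^2 = z^(n-j) p; the exponent is positive as j < n, so [cintegral_pole]
   applies. *)
pose k x := circle_val x ^+ (n - j) * p x : C.
have bk : bounded_measurable k by exact: bounded_measurableM.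
have fk x : f x * (w0 x)%:C = k x.
  rewrite /w0 add_Re2_Im2 sqr_normc /f /k circle_val_expB ?(ltnW jn)//.
  by rewrite /circle_poly hornerXn -PhiE /circle_poly; ring.
have [fr fi] := bounded_measurable_integrable mu bf.
have [kr ki] := bounded_measurable_integrable lambda bk.
have k0 : cintegral lambda k = 0 by apply: cintegral_pole; rewrite ?subn_gt0.
rewrite /ip /inner -/f /cintegral muE// [X in _ +i* X]muE//.
rewrite (eq_Rintegral _ (g := fun x => c^-1 * Re (k x))) => [|x _]; last first.
  by rewrite -fk; case: (f x) => a b /=; ring.
rewrite [X in _ +i* X](eq_Rintegral _ (g := fun x => c^-1 * Im (k x))) =>
  [|x _]; last first.
  by rewrite -fk; case: (f x) => a b /=; ring.
rewrite !RintegralZl//.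
by case: k0 => -> ->; rewrite !mulr0.
Qed.

Lemma mup_prod_XsubC (n : nat) (z : 'I_n -> C) a :
  mup a (\prod_(i < n) ('X - (z i)%:P)) = #|[pred i | z i == a]|.
Proof.
rewrite -sum1_card; elim: (index_enum _) => [|i r ih].
  by rewrite !big_nil mupNroot// root1.
rewrite !big_cons mupM ?polyXsubC_eq0 ?monic_neq0 ?monic_prod_XsubC//.
by rewrite ih -['X - _]expr1 mup_XsubCX inE; case: eqP.
Qed.

End BernsteinSzego.

Theorem theorem3 (R : realType) (n : nat) (n_gt0 : (0 < n)%N) :
  (forall z : 'I_n -> R[i], (forall i, `|z i| < 1) ->
    exists mu : probability (circle R) R,
      nontrivial mu /\
      forall a : R[i],
        alg_mult (compressed_mult mu n) a = #|[pred i | z i == a]|)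
  /\
  (forall mu nu : probability (circle R) R, nontrivial mu -> nontrivial nu ->
    op_char_poly (compressed_mult mu n) = op_char_poly (compressed_mult nu n) ->
    unitarily_equivalent mu nu (compressed_mult mu n) (compressed_mult nu n)).
Proof.
split=> [z z1|mu nu ntmu ntnu]; last exact: unitarily_equivalent_char_poly.
have [mu [ntmu omu]] := bernstein_szego z1.
exists mu; split => // a.
by rewrite /alg_mult (op_char_poly_opuc ntmu omu) mup_prod_XsubC.
Qed.
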